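(* Assume $d \ge 2$. Then almost surely \[ \liminf_{n \to \infty} \frac{r_n}{(\ln n)/(d \ln\ln n)} \ge 1. \]
   Context: Fix an integer $d \ge 2$. Let $X^{(1)}, X^{(2)}, \dots$ be i.i.d. random vectors in $\mathbb{R}^d$ with independent Exponential$(1)$ coordinates. Write $x \prec y$ if $x_j<y_j$ for all $j$. For $1 \le k \le n$, $X^{(k)}$ is a current record at time $n$ if $X^{(k)} \not\prec X^{(i)}$ for all $1 \le i \le n$; $r_n$ denotes the number of current records at time $n$. *)

(* Defs.v *)
From HB Require Import structures.
From mathcomp Require Import all_boot all_order all_algebra.
From mathcomp Require Import all_classical all_reals all_analysis.
Set Implicit Arguments. Unset Strict Implicit. Unset Printing Implicit Defensive.
Import Order.TTheory GRing.Theory Num.Theory.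
Local Open Scope classical_set_scope.
Local Open Scope ring_scope.

Definition mutually_independent {dT} {T : measurableType dT} {R : realType}
  (P : probability T R) (I : eqType) (Y : I -> {RV P >-> R}) : Prop :=
  forall (s : seq I) (B : I -> set R),
    uniq s -> (forall i, i \in s -> measurable (B i)) ->
    P (\bigcap_(i in [set` s]) (Y i @^-1` B i)) =
    (\prod_(i <- s) P (Y i @^-1` B i))%E.

Definition strictly_below {R : realType} (d : nat) (x y : 'I_d -> R) : bool :=
  [forall j, x j < y j].

(* r_n: number of current records at time n.  The vectors are indexed from 0:
   X k is the paper's X^(k+1), so X^(1..n) are X 0, ..., X (n-1). *)
Definition num_records {R : realType} (d : nat) (X : nat -> 'I_d -> R) (n : nat) : nat :=
  #|[set k : 'I_n | [forall i : 'I_n, ~~ strictly_below (X k) (X i)]]|.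

(* Main.v *)
Require Import Defs.
From HB Require Import structures.
From mathcomp Require Import all_boot all_order all_algebra.
From mathcomp Require Import all_classical all_reals all_analysis.
From mathcomp Require Import measurable_realfun ring lra.
Import Order.TTheory GRing.Theory Num.Theory.
Import numFieldNormedType.Exports.
Local Open Scope classical_set_scope.
Local Open Scope ring_scope.

(** Two coordinates suffice, since a point not strictly dominated in two of its
    coordinates is a record.  For [2 ^ k <= n < 2 ^ k.+1] consider a staircase
    of about [ln n / (2 ln ln n)] quadrants [{x_0 > s_i, x_1 > t_i}], with [s_i]
    increasing and [t_i] decreasing.  If a quadrant contains one of the first
    [n] points, the one with the largest [x_0] is a record; if moreover no point
    lies in two consecutive quadrants, these records are distinct, so that
    [r_n] is at least the number of quadrants.  Every quadrant has probability
    of order [ln k / 2 ^ k], so it is hit by time [2 ^ k] up to a probability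
    [k ^- 4], whereas the overlaps are rarer by a factor [(k ln k) ^ 2].  The
    failure probability at stage [k] is then at most [5 / (k (ln k) ^ 2)], which
    is dominated by the telescoping difference [5 / ln (k - 1) - 5 / ln k], and
    Borel-Cantelli applies. *)

(** * Records from a staircase of quadrants *)

Lemma staircase_le_num_records (R : realType) (d : nat)
    (X : nat -> 'I_d -> R) (j0 j1 : 'I_d) (s t : nat -> R) (K n : nat) :
  {homo s : i j / (i <= j)%N >-> i <= j} ->
  (forall i, (i < K)%N ->
     exists2 m, (m < n)%N & (s i < X m j0) && (t i < X m j1)) ->
  (forall i, (i < K)%N ->
     forall m, (m < n)%N -> ~~ ((s i.+1 < X m j0) && (t i < X m j1))) ->
  (K <= num_records X n)%N.
Proof.
move=> s_homo boxes overlaps.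
pose box (i : 'I_K) := [pred m : 'I_n | (s i < X m j0) && (t i < X m j1)].
have rec_ex (i : 'I_K) :
    exists m : 'I_n, box i m && [forall m' : 'I_n, ~~ strictly_below (X m) (X m')].
  have [m0 m0n bm0] := boxes i (ltn_ord i).
  case: (@arg_maxP _ _ _ (Ordinal m0n) (box i) (fun m : 'I_n => X m j0) bm0).
  move=> m bm mmax; exists m; rewrite bm /=; apply/forallP => m'.
  apply/negP => /forallP below.
  have bm' : box i m'.
    case/andP: bm => h0 h1.
    by rewrite /= (lt_trans h0 (below j0)) (lt_trans h1 (below j1)).
  by have /= := mmax m' bm'; rewrite leNgt (below j0).
pose rec i := xchoose (rec_ex i).
have recP i :
    box i (rec i) && [forall m' : 'I_n, ~~ strictly_below (X (rec i)) (X m')].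
  exact: (xchooseP (rec_ex i)).
(* Since [s] is monotone, a common point of boxes [i < j] lies beyond [s i.+1] and [t i], so
   excluding overlaps of neighbours separates all pairs. *)
have rec_lt (i j : 'I_K) : (i < j)%N -> rec i <> rec j.
  move=> ij eij; case/andP: (recP i) => /andP[_ h1] _.
  case/andP: (recP j); rewrite -eij => /andP[h0 _] _.
  move/negP: (overlaps i (ltn_ord i) (rec i) (ltn_ord _)); apply.
  by rewrite h1 andbT (le_lt_trans (s_homo _ _ ij) h0).
have rec_inj : injective rec.
  move=> i j eij; apply/val_inj/eqP.
  by case: (ltngtP i j) => // /rec_lt; [move/(_ eij)|move/(_ (esym eij))].
rewrite /num_records -[X in (X <= _)%N]card_ord -cardsT -(card_imset _ rec_inj).
apply/subset_leq_card/fintype.subsetP => m /imsetP[i _ ->].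
by rewrite inE; case/andP: (recP i).
Qed.

(** * Exponential tails and a telescoping bound *)

Lemma exponential_prob_gt (R : realType) (s : R) : 0 <= s ->
  exponential_prob 1 `]s, +oo[%classic = (expR (- s))%:E.
Proof.
move=> s0.
rewrite /exponential_prob integral_itv_obnd_cbnd; last first.
  apply/measurable_EFinP; apply: measurable_funTS.
  exact: measurable_exponential_pdf.
rewrite (@ge0_continuous_FTC2y _ _
  (fun x => - (expR (- 1 * x))) _ 0)//.
- by rewrite mulN1r sub0e EFinN oppeK.
- by move=> x _; apply: exponential_pdf_ge0.
- apply: (@continuous_subspaceW R^o _ _ [set` `[0, +oo[%R]).
  + by apply: subset_itvr; rewrite bnd_simp.
  + exact: within_continuous_exponential_pdf.
- rewrite -oppr0; apply: (@cvgN _ R^o).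
  under eq_fun do rewrite mulN1r.
  exact: cvgr_expR.
- apply: (@cvgN _ R^o); apply: cvg_at_right_filter.
  apply: (@continuous_comp R^o R^o R^o (fun z => -1 * z) expR s).
    exact: mulrl_continuous.
  exact: continuous_expR.
- move=> x; rewrite in_itv /= andbT => sx; apply: derive1_exponential_pdf.
  by rewrite in_itv /= andbT (le_lt_trans s0).
Qed.

(** Discrete form of the fact that [1 / ln x] has derivative [- 1 / (x (ln x) ^ 2)]: the bound
    [ln (1 - 1/k) <= - 1/k] gives [1/k <= ln k - ln (k - 1)], which is divided by
    [ln (k - 1) * ln k <= (ln k) ^ 2]. *)
Lemma le_inv_nln2_telescope (R : realType) (k : nat) : (3 <= k)%N ->
  (k%:R * ln k%:R ^+ 2)^-1 <= (ln k.-1%:R)^-1 - (ln k%:R)^-1 :> R.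
Proof.
case: k => // k k3 /=.
have k2 : 2 <= k%:R :> R by rewrite (ler_nat R 2).
have lk : 0 < ln (k%:R : R) by apply: ln_gt0; lra.
have k1 : k.+1%:R = k%:R + 1 :> R by rewrite -natr1.
have lk1 : ln (k%:R : R) < ln k.+1%:R by rewrite ltr_ln ?posrE ?ltr_nat//; lra.
have h : (k.+1%:R)^-1 <= ln k.+1%:R - ln k%:R :> R.
  rewrite -opprB lerNr -ln_div ?posrE; [|lra|lra].
  have -> : k%:R / k.+1%:R = 1 + (- k.+1%:R^-1) :> R.
    by rewrite k1; field; lra.
  apply: le_ln1Dx; rewrite ltrN2 invf_lt1; lra.
have lk1' : 0 < ln (k.+1%:R : R) by exact: lt_trans lk lk1.
have -> : (ln k%:R)^-1 - (ln k.+1%:R)^-1 =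
    (ln k.+1%:R - ln k%:R) / (ln k%:R * ln k.+1%:R) :> R.
  by field; apply/andP; split; lra.
rewrite invfM; apply: ler_pM => //.
  by rewrite invr_ge0 sqr_ge0.
rewrite lef_pV2 ?posrE ?exprn_gt0 ?mulr_gt0// expr2 ler_pM2r//.
exact: ltW.
Qed.

(** * Probability that a quadrant is hit *)

(** The product formula passes to complements one event at a time, which replaces
    inclusion-exclusion. *)
Lemma probability_bigcap_setC (dT : measure_display) (T : measurableType dT)
    (R : realType) (P : probability T R) (A : nat -> set T) (p : R) :
  (forall m, measurable (A m)) ->
  (forall l : seq nat, uniq l ->
     P (\bigcap_(m in [set` l]) A m) = (p ^+ size l)%:E) ->
  forall n, P (\bigcap_(m < n) ~` A m) = ((1 - p) ^+ n)%:E.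
Proof.
move=> mA PA n.
have mCap (D : set nat) (F : nat -> set T) : (forall m, measurable (F m)) ->
    measurable (\bigcap_(m in D) F m).
  by move=> mF; apply: bigcap_measurableType => *; exact: mF.
(* Events with indices at least [n] are carried along, because subtracting the part of [G] inside
   [A n] moves [n] into [l]. *)
suff main (l : seq nat) : uniq l -> all (leq n) l ->
    P ((\bigcap_(m < n) ~` A m) `&` \bigcap_(m in [set` l]) A m) =
    ((1 - p) ^+ n * p ^+ size l)%:E.
  have := main [::] isT isT; rewrite expr0 mulr1 => <-; congr (P _).
  by apply/seteqP; split => [w wA|w [wA _]//]; split.
elim: n l => [|n IH] l ul nl.
  rewrite expr0 mul1r -PA//; congr (P _).
  by apply/seteqP; split => [w []//|w wA]; split.
set G := (\bigcap_(m < n) ~` A m) `&` \bigcap_(m in [set` l]) A m.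
have nl' : all (leq n) l by apply: sub_all nl => m; exact: ltnW.
have -> : (\bigcap_(m < n.+1) ~` A m) `&` \bigcap_(m in [set` l]) A m = G `\` A n.
  apply/seteqP; split => w.
    move=> [h1 h2]; split; last by apply: (h1 n) => /=.
    by split=> // m /= mn; apply: h1; exact: ltnW.
  move=> [[h1 h2] h3]; split=> // m /=; rewrite ltnS leq_eqVlt => /orP[/eqP->//|mn].
  exact: h1.
have mG : measurable G by apply: measurableI; apply: mCap => // m; exact: measurableC.
have -> : P (G `\` A n) = (P G - P (G `&` A n))%E.
  by apply: measureD => //; apply: le_lt_trans (probability_le1 P mG) _; exact: ltry.
have -> : G `&` A n = (\bigcap_(m < n) ~` A m) `&` \bigcap_(m in [set` n :: l]) A m.
  apply/seteqP; split => w.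
    move=> [[h1 h2] h3]; split=> // m /=; rewrite inE => /orP[/eqP->//|]; exact: h2.
  move=> [h1 h2]; split; last by apply: h2; rewrite /= inE eqxx.
  by split=> // m /= ml; apply: h2; rewrite /= inE ml orbT.
rewrite IH /=; first last.
- by rewrite leqnn nl'.
- by rewrite ul andbT; apply/negP => /(allP nl); rewrite ltnn.
- by rewrite /G IH// -EFinB !exprS; congr EFin; ring.
Qed.

Definition exceed {T : Type} {R : realType} (Y Z : nat -> T -> R) (s t : R)
  (m : nat) : set T := [set w | s < Y m w /\ t < Z m w].

Lemma measurable_exceed (dT : measure_display) (T : measurableType dT)
    (R : realType) (P : probability T R) (Y Z : nat -> {RV P >-> R}) (s t : R) m :
  measurable (exceed Y Z s t m).
Proof.
have -> : exceed Y Z s t m = (Y m @^-1` `]s, +oo[) `&` (Z m @^-1` `]t, +oo[).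
  by apply/seteqP; split => w /=; rewrite !in_itv /= !andbT.
by apply: measurableI; rewrite -[X in measurable X]setTI; exact: measurable_funP.
Qed.

Lemma probability_bigcap_exceed (dT : measure_display) (T : measurableType dT)
    (R : realType) (P : probability T R) (d : nat)
    (X : nat -> 'I_d -> {RV P >-> R}) (j0 j1 : 'I_d) (s t : R) (l : seq nat) :
  mutually_independent (fun kj : nat * 'I_d => X kj.1 kj.2) ->
  (forall k j (A : set R), measurable A ->
     P (X k j @^-1` A) = exponential_prob 1 A) ->
  j0 != j1 -> 0 <= s -> 0 <= t -> uniq l ->
  P (\bigcap_(m in [set` l]) exceed (X^~ j0) (X^~ j1) s t m) =
    (expR (- (s + t)) ^+ size l)%:E.
Proof.
move=> hindep hexp j01 s0 t0 ul.
(* [B] and [l2] flatten the two coordinates of each vector into one family of distinct variables, so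
   that [hindep] applies once. *)
pose B (kj : nat * 'I_d) : set R :=
  if kj.2 == j0 then `]s, +oo[%classic else `]t, +oo[%classic.
pose l2 := [seq (m, j0) | m <- l] ++ [seq (m, j1) | m <- l].
have ul2 : uniq l2.
  rewrite cat_uniq !map_inj_uniq ?ul//= ?andbT.
  - apply/hasPn => _ /mapP[m _ ->]; apply/negP => /mapP[m' _ [_ e]].
    by rewrite e eqxx in j01.
  - by move=> a b [].
  - by move=> a b [].
have mB kj : measurable (B kj) by rewrite /B; case: ifP.
have := hindep l2 B ul2 (fun i _ => mB i).
have -> : \bigcap_(i in [set` l2]) (X i.1 i.2 @^-1` B i) =
    \bigcap_(m in [set` l]) exceed (X^~ j0) (X^~ j1) s t m.
  apply/seteqP; split => w h.
    move=> m ml; split.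
      have := h (m, j0); rewrite /= /B /= eqxx /= in_itv /= andbT; apply.
      by rewrite mem_cat map_f.
    have := h (m, j1); rewrite /= /B /= eq_sym (negbTE j01) /= in_itv /= andbT; apply.
    by rewrite mem_cat [in X in _ || X]map_f// orbT.
  move=> [m j] /=; rewrite mem_cat => /orP[] /mapP[m' m'l [-> ->]];
    have [h0 h1] := h m' m'l; rewrite /B /=.
    by rewrite eqxx /= in_itv /= andbT.
  by rewrite eq_sym (negbTE j01) /= in_itv /= andbT.
move=> ->; rewrite big_cat /= !big_map /=.
under eq_bigr do rewrite hexp// /B/= eqxx exponential_prob_gt//.
under [X in (_ * X)%E]eq_bigr do
  rewrite hexp// /B/= eq_sym (negbTE j01) exponential_prob_gt//.
rewrite !prodEFin -EFinM -big_split /=; congr EFin.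
by rewrite big_const_seq count_predT -Monoid.iteropE /= opprD expRD.
Qed.

(** Independence gives [(1 - p) ^ n] with [p = expR (- (s + t))], and [1 - p <= expR (- p)]. *)
Lemma probability_no_exceed_le (dT : measure_display) (T : measurableType dT)
    (R : realType) (P : probability T R) (d : nat)
    (X : nat -> 'I_d -> {RV P >-> R}) (j0 j1 : 'I_d) (s t : R) (n : nat) :
  mutually_independent (fun kj : nat * 'I_d => X kj.1 kj.2) ->
  (forall k j (A : set R), measurable A ->
     P (X k j @^-1` A) = exponential_prob 1 A) ->
  j0 != j1 -> 0 <= s -> 0 <= t ->
  (P (\bigcap_(m < n) ~` exceed (X^~ j0) (X^~ j1) s t m) <=
    (expR (- (n%:R * expR (- (s + t)))))%:E)%E.
Proof.
move=> hindep hexp j01 s0 t0.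
rewrite (@probability_bigcap_setC _ _ _ _ _ (expR (- (s + t)))); first last.
- by move=> l ul; exact: probability_bigcap_exceed.
- by move=> m; exact: measurable_exceed.
rewrite lee_fin -mulrN expRM_natl lerXn2r ?nnegrE ?expR_ge0//.
  by rewrite subr_ge0 expR_le1 oppr_le0 addr_ge0.
exact: expR_ge1Dx.
Qed.

Lemma probability_ex_exceed_le (dT : measure_display) (T : measurableType dT)
    (R : realType) (P : probability T R) (d : nat)
    (X : nat -> 'I_d -> {RV P >-> R}) (j0 j1 : 'I_d) (s t : R) (n : nat) :
  mutually_independent (fun kj : nat * 'I_d => X kj.1 kj.2) ->
  (forall k j (A : set R), measurable A ->
     P (X k j @^-1` A) = exponential_prob 1 A) ->
  j0 != j1 -> 0 <= s -> 0 <= t ->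
  (P (\big[setU/set0]_(m < n) exceed (X^~ j0) (X^~ j1) s t m) <=
    (n%:R * expR (- (s + t)))%:E)%E.
Proof.
move=> hindep hexp j01 s0 t0.
apply: le_trans.
  by apply: Boole_inequality => m _; exact: measurable_exceed.
rewrite (eq_bigr (fun=> (expR (- (s + t)))%:E)).
  by rewrite sumEFin sumr_const card_ord mulr_natl.
move=> m _.
have := @probability_bigcap_exceed _ _ _ _ _ _ j0 j1 s t [:: nat_of_ord m]
  hindep hexp j01 s0 t0 isT.
by rewrite /= expr1 set_cons1 bigcap_set1.
Qed.

(** * Parameters of the staircase at stage [k] *)

(* During [2 ^ k <= n < 2 ^ k.+1] the [i]-th box is
   [{x | i * spacing k < x_0 /\ level k - i * spacing k < x_1}], for
   [i < num_steps k].  The constants are chosen so that a point falls in a given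
   box with probability [expR (- level k) = 4 ln k / 2 ^ k] and in two
   consecutive ones with a probability smaller by the factor [(k ln k) ^- 2]. *)
Definition spacing {R : realType} (k : nat) : R := 2 * ln (k%:R * ln k%:R).

Definition level {R : realType} (k : nat) : R := ln (2 ^+ k / (4 * ln k%:R)).

Definition num_steps (R : realType) (k : nat) : nat :=
  Num.truncn (level k / spacing k : R).

Lemma ln_ge1 (R : realType) (k : nat) : (4 <= k)%N -> 1 <= ln (k%:R : R).
Proof.
move=> k4; have : 4 <= k%:R :> R by rewrite (ler_nat R 4).
move=> k4'; apply: le_trans (_ : ln (4 : R) <= _); last first.
  by rewrite ler_ln ?posrE//; lra.
(* [ln 4 = - 2 * ln (1 - 1/2)], and [ln (1 - 1/2) <= - 1/2]. *)
have -> : (4 : R) = (2^-1 ^+ 2)^-1 by field.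
rewrite lnV ?posrE ?exprn_gt0 ?invr_gt0// lnXn ?invr_gt0//.
have : ln (1 + (- 2^-1) : R) <= - 2^-1 by apply: le_ln1Dx; lra.
rewrite (_ : 1 + - 2^-1 = 2^-1 :> R); last by field.
by move=> ?; rewrite [ln _ *+ 2]mulr2n; lra.
Qed.

Lemma ln2_le1 (R : realType) : ln (2 : R) <= 1.
Proof. by have := @le_ln1Dx R 1; rewrite (_ : 1 + 1 = 2 :> R)//; apply; lra. Qed.

Lemma spacing_ge (R : realType) (k : nat) : (4 <= k)%N ->
  2 * ln k%:R <= spacing k :> R.
Proof.
move=> k4; have l1 := ln_ge1 R k k4.
have k4' : 4 <= k%:R :> R by rewrite (ler_nat R 4).
rewrite /spacing ler_pM2l// ler_ln ?posrE; [|lra|apply: mulr_gt0; lra].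
by rewrite ler_peMr//; lra.
Qed.

Lemma expRN_spacing (R : realType) (k : nat) : (4 <= k)%N ->
  expR (- spacing k) = (k%:R * ln k%:R) ^- 2 :> R.
Proof.
move=> k4; have l1 := ln_ge1 R k k4.
have k4' : 4 <= k%:R :> R by rewrite (ler_nat R 4).
rewrite expRN /spacing expRM_natl lnK// posrE mulr_gt0//; lra.
Qed.

Lemma expRN_level (R : realType) (k : nat) : (4 <= k)%N ->
  expR (- level k) = 4 * ln k%:R / 2 ^+ k :> R.
Proof.
move=> k4; have l1 := ln_ge1 R k k4.
rewrite expRN lnK ?invf_div// posrE divr_gt0 ?exprn_gt0//; lra.
Qed.

Lemma level_le (R : realType) (k : nat) : (4 <= k)%N -> level k <= k%:R :> R.
Proof.
move=> k4; have l1 := ln_ge1 R k k4.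
have p2 : 0 < 2 ^+ k :> R by rewrite exprn_gt0.
apply: le_trans (_ : ln (2 ^+ k) <= _).
  rewrite ler_ln ?posrE// ?divr_gt0//; last lra.
  by rewrite ler_pdivrMr ?ler_peMr ?(ltW p2)//; lra.
by rewrite lnXn//; apply: ler_wMn2r; exact: ln2_le1.
Qed.

(** Rounding down in [num_steps] keeps the thresholds nonnegative, as the exponential tail formula
    requires. *)
Lemma level_sub_ge0 (R : realType) (k i : nat) : (4 <= k)%N ->
  (i < num_steps R k)%N -> 0 <= level k - i%:R * spacing k :> R.
Proof.
move=> k4; rewrite truncn_gt_nat => iK.
have sp := spacing_ge R k k4; have l1 := ln_ge1 R k k4.
rewrite ler_pdivlMr in iK; last lra.
rewrite subr_ge0; apply: le_trans iK; rewrite ler_pM2r ?ler_nat//; lra.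
Qed.

(** The gain [1 / ln k] in this count makes the union bound over the boxes summable in [k]. *)
Lemma num_steps_le (R : realType) (k : nat) : (4 <= k)%N ->
  (num_steps R k)%:R * (2 * ln k%:R) <= k%:R :> R.
Proof.
move=> k4; have sp := spacing_ge R k k4; have l1 := ln_ge1 R k k4.
case E : (num_steps R k) => [|i]; first by rewrite mul0r.
have : (i < num_steps R k)%N by rewrite E.
rewrite truncn_gt_nat ler_pdivlMr; last lra.
move=> h; apply: le_trans (level_le R k k4); apply: le_trans h.
by rewrite ler_pM2l// ltr0n.
Qed.

(* The two summands bound the probabilities that a given box is still empty at
   time [2 ^ k] and that its overlap with the next one is hit before time
   [2 ^ k.+1]. *)
Lemma stage_failure_le (R : realType) (k : nat) : (4 <= k)%N ->
  (num_steps R k)%:R * (expR (- (2 ^+ k * expR (- level k)))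
                        + 2 ^+ k.+1 * expR (- (level k + spacing k)))
    <= 5 * (k%:R * ln k%:R ^+ 2)^-1 :> R.
Proof.
move=> k4; have l1 := ln_ge1 R k k4.
have k4' : 4 <= k%:R :> R by rewrite (ler_nat R 4).
have lk : ln (k%:R : R) < k%:R by apply: ln_sublinear; lra.
have p2 : 0 < 2 ^+ k :> R by rewrite exprn_gt0.
rewrite opprD expRD expRN_level// expRN_spacing//.
have -> : 2 ^+ k * (4 * ln k%:R / 2 ^+ k) = 4%:R * ln k%:R :> R by field; lra.
rewrite expRN expRM_natl lnK ?posrE; last lra.
have K := num_steps_le R k k4.
set N : R := (num_steps R k)%:R in K *.
have N0 : 0 <= N by rewrite ler0n.
move: l1 lk K k4'; set x : R := k%:R; set l := ln x => l1 lk K x4.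
have Nx : N <= x.
  by apply: le_trans K; rewrite ler_peMr//; lra.
have x0 : 0 < x by lra.
have l0 : 0 < l by lra.
(* One unit pays for the empty boxes, which contribute at most [k ^- 3] in total; four pay for the
   overlaps, where [num_steps_le] absorbs the factor [2 * ln k]. *)
have -> : 5 * (x * l ^+ 2)^-1 = (x * l ^+ 2)^-1 + 4 / (x * l ^+ 2) by ring.
rewrite mulrDr; apply: lerD.
  rewrite ler_pdivrMr ?exprn_gt0// mulrC ler_pdivlMr ?mulr_gt0 ?exprn_gt0//.
  rewrite (_ : x ^+ 4 = x * (x * x ^+ 2)); last by ring.
  apply: ler_pM => //; first by rewrite mulr_ge0 ?sqr_ge0 ?ltW.
  by rewrite ler_pM2l// lerXn2r ?nnegrE; lra.
have -> : N * (2 ^+ k.+1 * (4 * l / 2 ^+ k * (x * l) ^- 2)) =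
  4 * (N * (2 * l)) / (x * l) ^+ 2.
  by rewrite exprS; field; rewrite !gt_eqF.
rewrite ler_pdivrMr ?exprn_gt0 ?mulr_gt0//.
rewrite (_ : 4 / (x * l ^+ 2) * (x * l) ^+ 2 = 4 * x); last by field; rewrite !gt_eqF.
by rewrite ler_pM2l.
Qed.

(** * Asymptotics of the number of boxes *)

(** Write [y = (2 / c) * (c * y / 2)] and use [ln z <= z - 1] on the second factor; the other half
    of [c * y] absorbs [ln (2 / c)]. *)
Lemma ln_le_mulr (R : realType) (c y : R) : 0 < c -> 0 < y ->
  2 * ln (2 / c) <= c * y -> ln y <= c * y.
Proof.
move=> c0 y0 h.
have c2 : 0 < 2 / c by rewrite divr_gt0.
have -> : y = (2 / c) * (c * y / 2) by field; lra.
have cy : 0 < c * y by rewrite mulr_gt0.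
rewrite lnM ?posrE//; last lra.
have : ln (1 + (c * y / 2 - 1)) <= c * y / 2 - 1 by apply: le_ln1Dx; lra.
rewrite addrC subrK => h2.
have -> : c * (2 / c * (c * y / 2)) = c * y by field; lra.
lra.
Qed.

Lemma ln2_ge (R : realType) : 2^-1 <= ln (2 : R).
Proof.
have := ln_ge1 R 4 isT.
rewrite (_ : (4%:R : R) = 2 ^+ 2); last by ring.
by rewrite lnXn// mulr2n; lra.
Qed.

(** For [2 ^ k <= n < 2 ^ k.+1], [k.+1 * ln 2] bounds [ln n] above and [ln (k * ln 2)] bounds
    [ln (ln n)] below. Level, spacing and rounding each lose a relative error [e], whence
    [3 * e]. *)
Lemma num_steps_asymptotic (R : realType) (e : R) : 0 < e -> e <= 3^-1 ->
  exists k0, forall k, (k0 <= k)%N ->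
    (4 <= k)%N /\
    (1 - 3 * e) * (k.+1%:R * ln 2) <= (num_steps R k)%:R * (2 * ln (k%:R * ln 2)).
Proof.
move=> e0 e1; pose c : R := e / 8.
have c0 : 0 < c by rewrite /c; lra.
(* From [y0] on, [ln y <= c * y] and [1 <= c * y], so logarithms and constants are absorbed. *)
pose y0 : R := Num.max (2 * ln (2 / c) / c) (c^-1).
exists (maxn 4 (Num.truncn (expR y0)).+1) => k; rewrite geq_max => /andP[k4 kt].
split=> //.
have kE : expR y0 < k%:R.
  by apply: lt_le_trans (truncnS_gt _) _; rewrite ler_nat.
have x4 : 4 <= k%:R :> R by rewrite (ler_nat R 4).
have yu : y0 <= ln k%:R.
  by rewrite -ler_expR lnK ?posrE ?(ltW kE)//; lra.
have u1 := ln_ge1 R k k4.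
have ux : ln (k%:R : R) < k%:R by apply: ln_sublinear; lra.
have sp := spacing_ge R k k4.
have a1 := ln2_le1 R; have a2 := ln2_ge R.
have lev : level k = k%:R * ln 2 - (2 * ln 2 + ln (ln k%:R)) :> R.
  rewrite /level ln_div ?posrE ?exprn_gt0//; last lra.
  rewrite lnXn// -[ln 2 *+ k]mulr_natl lnM ?posrE//; last lra.
  rewrite (_ : (4 : R) = 2 ^+ 2); last by ring.
  by rewrite lnXn// [_ *+ 2]mulr2n; ring.
have spE : spacing k = 2 * (ln k%:R + ln (ln k%:R)) :> R.
  by rewrite /spacing lnM ?posrE//; lra.
rewrite (lnM (_ : k%:R \is Num.pos)) ?posrE; [|lra|lra].
have la1 : -1 <= ln (ln (2 : R)).
  have a0 : 0 < ln (2 : R) by lra.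
  have /(le_trans _) : ln (1 + ((ln (2 : R))^-1 - 1)) <= (ln (2 : R))^-1 - 1.
    by apply: le_ln1Dx; have : 0 < (ln (2 : R))^-1 by [rewrite invr_gt0]; lra.
  rewrite addrC subrK lnV ?posrE// => /(_ _ (lexx _)) h.
  have : (ln (2 : R))^-1 <= 2 by rewrite invf_ple ?posrE//; lra.
  by lra.
have la2 : ln (ln (2 : R)) <= 0 by apply: ln_le0.
have y0c (y : R) : y0 <= y -> 2 * ln (2 / c) <= c * y /\ 1 <= c * y.
  rewrite /y0 ge_max => /andP[]; rewrite ler_pdivrMr// => h1 h2.
  by rewrite ![c * y]mulrC; split=> //; rewrite -ler_pdivrMr// div1r.
have [h1 h2] := y0c _ yu.
have h3 : ln (ln k%:R) <= c * ln k%:R by apply: ln_le_mulr => //; lra.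
have [h4 _] := y0c k%:R (le_trans yu (ltW ux)).
have h5 : ln k%:R <= c * k%:R by apply: ln_le_mulr => //; lra.
have lu0 : 0 <= ln (ln (k%:R : R)) by apply: ln_ge0.
have KL : level k / spacing k < (num_steps R k)%:R + 1 :> R.
  by have := truncnS_gt (level k / spacing k : R); rewrite -natr1.
rewrite ltr_pdivrMr in KL; last lra.
rewrite lev in KL.
have k1 : k.+1%:R = k%:R + 1 :> R by rewrite -natr1.
rewrite k1.
move: spE sp KL u1 ux yu h1 h2 h3 h4 h5 lu0 a1 a2 la1 la2 x4.
set L := spacing k; set N : R := (num_steps R k)%:R; set lu := ln (ln k%:R).
set u := ln k%:R; set x : R := k%:R; set a := ln 2; set la := ln a.
move=> spE sp KL u1 ux yu h1 h2 h3 h4 h5 lu0 a1 a2 la1 la2 x4.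
have ec : e = 8 * c by rewrite /c; field.
(* [D] is the ideal numerator and [W] the ideal denominator; [A], [B], [C] bound the losses from
   level, spacing and rounding, and [(1 - e) ^ 2 - e >= 1 - 3 * e]. *)
pose D := (x + 1) * a; pose W := 2 * (u + la).
have cx : c * u <= c * x by rewrite ler_pM2l// ltW.
have D0 : x / 2 <= D by rewrite /D; nra.
have A : (1 - e) * D <= x * a - (2 * a + lu).
  have : 4 * (c * x) <= e * x * a by rewrite ec; nra.
  rewrite /D; nra.
have B : (1 - e) * L <= W.
  rewrite spE /W ec; nra.
have C : W <= e * D by rewrite /W ec; nra.
rewrite -/D -/W.
have W0 : 0 <= W by rewrite /W; nra.
have L0 : 0 < L by lra.
have : (x * a - (2 * a + lu)) / L * W <= (N + 1) * W.
  by rewrite ler_wpM2r// ler_pdivrMr// ltW.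
have BL : 1 - e <= W / L by rewrite ler_pdivlMr.
have D0' : 0 <= D by lra.
have : (1 - e) * D * (1 - e) <= (x * a - (2 * a + lu)) * (W / L).
  apply: ler_pM => //; last lra.
  apply: mulr_ge0 => //; lra.
rewrite mulrAC -mulrA => g1 g2.
have eD : 0 <= e * e * D := mulr_ge0 (mulr_ge0 (ltW e0) (ltW e0)) D0'.
lra.
Qed.

(** * Failure of a dyadic stage *)

(** Emptiness is tested on the first [2 ^ k] points and overlaps on the first [2 ^ k.+1]: both are
    monotone in [n], so one event covers the whole dyadic range. *)
Definition stage_failure {T : Type} {R : realType} (Y Z : nat -> T -> R)
    (k i : nat) : set T :=
  (\bigcap_(m < 2 ^ k)
     ~` exceed Y Z (i%:R * spacing k) (level k - i%:R * spacing k) m) `|`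
  (\big[setU/set0]_(m < 2 ^ k.+1)
     exceed Y Z (i.+1%:R * spacing k) (level k - i%:R * spacing k) m).

Definition bad_stage {T : Type} {R : realType} (Y Z : nat -> T -> R)
    (k : nat) : set T :=
  \big[setU/set0]_(i < num_steps R k) stage_failure Y Z k i.

Lemma measurable_stage_failure (dT : measure_display) (T : measurableType dT)
    (R : realType) (P : probability T R) (Y Z : nat -> {RV P >-> R}) (k i : nat) :
  measurable (stage_failure Y Z k i).
Proof.
apply: measurableU.
  apply: bigcap_measurableType => m _.
  by apply: measurableC; exact: measurable_exceed.
by apply: bigsetU_measurable => m _; exact: measurable_exceed.
Qed.

Lemma measurable_bad_stage (dT : measure_display) (T : measurableType dT)
    (R : realType) (P : probability T R) (Y Z : nat -> {RV P >-> R}) (k : nat) :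
  measurable (bad_stage Y Z k).
Proof.
by apply: bigsetU_measurable => i _; exact: measurable_stage_failure.
Qed.

Lemma probability_bad_stage_le (dT : measure_display) (T : measurableType dT)
    (R : realType) (P : probability T R) (d : nat)
    (X : nat -> 'I_d -> {RV P >-> R}) (j0 j1 : 'I_d) (k : nat) :
  mutually_independent (fun kj : nat * 'I_d => X kj.1 kj.2) ->
  (forall k j (A : set R), measurable A ->
     P (X k j @^-1` A) = exponential_prob 1 A) ->
  j0 != j1 -> (4 <= k)%N ->
  (P (bad_stage (X^~ j0) (X^~ j1) k) <=
    (5 * ((ln k.-1%:R)^-1 - (ln k%:R)^-1))%:E)%E.
Proof.
move=> hindep hexp j01 k4.
pose q : R := expR (- (2 ^+ k * expR (- level k)))
              + 2 ^+ k.+1 * expR (- (level k + spacing k)).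
apply: (@le_trans _ _ ((num_steps R k)%:R * q)%:E); last first.
  rewrite lee_fin; apply: le_trans (stage_failure_le R k k4) _.
  by rewrite ler_pM2l// le_inv_nln2_telescope// ltnW.
apply: le_trans.
  by apply: Boole_inequality => i _; exact: measurable_stage_failure.
apply: (@le_trans _ _ (\sum_(i < num_steps R k) q%:E)%E); last first.
  by rewrite sumEFin sumr_const card_ord mulr_natl.
apply: lee_sum => i _.
have sp : 0 <= spacing k :> R.
  by have := spacing_ge R k k4; have := ln_ge1 R k k4; lra.
have t0 := level_sub_ge0 R k i k4 (ltn_ord i).
apply: le_trans.
  apply: measureU2; first by apply: bigcap_measurableType => m _;
    apply: measurableC; exact: measurable_exceed.
  by apply: bigsetU_measurable => m _; exact: measurable_exceed.
rewrite /q EFinD; apply: leeD.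
  (* The thresholds of a box add up to [level k] for every [i], those of an overlap to
     [level k + spacing k]. *)
  have := @probability_no_exceed_le _ _ _ _ _ _ j0 j1 (i%:R * spacing k)
    (level k - i%:R * spacing k) (2 ^ k)%N
    hindep hexp j01 (mulr_ge0 (ler0n _ _) sp) t0.
  by rewrite natrX [_ + (level k - _)]addrC subrK.
have := @probability_ex_exceed_le _ _ _ _ _ _ j0 j1 (i.+1%:R * spacing k)
    (level k - i%:R * spacing k) (2 ^ k.+1)%N
    hindep hexp j01 (mulr_ge0 (ler0n _ _) sp) t0.
rewrite natrX (_ : i.+1%:R * spacing k + _ = level k + spacing k)//.
by rewrite -natr1; ring.
Qed.

Lemma num_steps_le_num_records (T : Type) (R : realType) (d : nat)
    (X : nat -> 'I_d -> T -> R) (j0 j1 : 'I_d) (k n : nat) (w : T) :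
  (4 <= k)%N -> (2 ^ k <= n < 2 ^ k.+1)%N ->
  ~ bad_stage (X^~ j0) (X^~ j1) k w ->
  (num_steps R k <= num_records (fun m j => X m j w) n)%N.
Proof.
move=> k4 /andP[kn nk]; rewrite /bad_stage -bigcup_mkord => good.
have sp : 0 <= spacing k :> R.
  by have := spacing_ge R k k4; have := ln_ge1 R k k4; lra.
apply: (@staircase_le_num_records R d _ j0 j1 (fun i => i%:R * spacing k)
  (fun i => level k - i%:R * spacing k)).
- by move=> i j ij; rewrite ler_wpM2r// ler_nat.
- move=> i iK; apply: contrapT => no; apply: good; exists i => //; left.
  move=> m /= mk [h0 h1]; apply: no; exists m; first exact: leq_trans mk kn.
  by rewrite h0 h1.
- move=> i iK m mn; apply/negP => /andP[h0 h1]; apply: good; exists i => //; right.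
  by rewrite -bigcup_mkord; exists m => //=; exact: ltn_trans mn nk.
Qed.

(** * Borel-Cantelli and lower limits *)

(** From [k0] on the partial sums telescope to at most [g k0], so Borel-Cantelli makes the upper
    limit set null. *)
Lemma ae_eventually_not_of_telescope (dT : measure_display)
    (T : measurableType dT) (R : realType) (P : probability T R)
    (F : nat -> set T) (g : nat -> R) (k0 : nat) :
  (forall k, measurable (F k)) -> (forall k, 0 <= g k) ->
  (forall k, (k0 <= k)%N -> (P (F k) <= (g k - g k.+1)%:E)%E) ->
  {ae P, forall w, exists k1, forall k, (k1 <= k)%N -> ~ F k w}.
Proof.
move=> mF g0 PF.
pose G k := F (k0 + k)%N.
have mG k : measurable (G k) by exact: mF.
have sumG : (\sum_(k <oo) P (G k) < +oo)%E.
  apply: le_lt_trans (ltry (g k0)).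
  apply: lime_le; first exact: is_cvg_nneseries.
  apply: nearW => n.
  apply: (@le_trans _ _ (\sum_(0 <= k < n) (g (k0 + k)%N - g (k0 + k.+1)%N)%:E)%E).
    by apply: lee_sum => k _; rewrite /G addnS; apply: PF; exact: leq_addr.
  rewrite sumEFin lee_fin.
  rewrite (@telescope_sumr_eq _ 0 n (fun k => - g (k0 + k)%N))//.
    by rewrite addn0 opprK addrC lerBlDr lerDl.
  by move=> k _; rewrite opprK addrC.
exists (lim_sup_set G); split.
- by apply: bigcap_measurable => // n _; exact: bigcup_measurable.
- exact: lim_sup_set_cvg0.
- move=> w /= nw n _; apply: contrapT => no; apply: nw; exists (k0 + n)%N => k nk Fk.
  apply: no; exists (k - k0)%N; first by rewrite /= leq_subRL// (leq_trans _ nk)// leq_addr.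
  by rewrite /G subnKC// (leq_trans _ nk)// leq_addr.
Qed.

Lemma le_limn_einf (R : realType) (u : nat -> R) (l : R) :
  (forall e : R, 0 < e -> exists N, forall n, (N <= n)%N -> l - e <= u n) ->
  (l%:E <= limn_einf (fun n => (u n)%:E))%E.
Proof.
move=> h; apply/lee_addgt0Pr => e e0; have [N hN] := h e e0.
rewrite -leeBlDr// -EFinB limn_einf_lim; apply: lime_ge; first exact: is_cvg_einfs.
near=> n; apply: le_ereal_inf_tmp => _ [m /= nm <-].
rewrite lee_fin; apply: hN; apply: leq_trans nm.
by near: n; exists N.
Unshelve. all: by end_near. Qed.

(** * Comparison of the record count with its rate *)

Theorem theorem3p4 (R : realType) (d : nat) (hd : (2 <= d)%N)
  (dT : measure_display) (T : measurableType dT) (P : probability T R)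
  (X : nat -> 'I_d -> {RV P >-> R})
  (hindep : mutually_independent (fun kj : nat * 'I_d => X kj.1 kj.2))
  (hexp : forall k j (A : set R), measurable A ->
            P (X k j @^-1` A) = exponential_prob 1 A) :
  {ae P, forall w : T,
     (1%:E <= limn_einf (fun n : nat =>
        ((num_records (fun k j => X k j w) n)%:R
           / (ln (n%:R : R) / (d%:R * ln (ln (n%:R : R)))))%:E))%E}.
Proof.
have d1 : (1 < d)%N by [].
pose j0 : 'I_d := Ordinal (ltnW d1); pose j1 : 'I_d := Ordinal d1.
have j01 : j0 != j1 by [].
have : {ae P, forall w, exists k1, forall k, (k1 <= k)%N ->
    ~ bad_stage (X^~ j0) (X^~ j1) k w}.
  apply: (@ae_eventually_not_of_telescope _ _ _ _ _ (fun k => 5 * (ln k.-1%:R)^-1) 4).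
  - by move=> k; exact: measurable_bad_stage.
  (* At indices 0 and 1 the term involves [ln 0], which is 0 by convention. *)
  - move=> [|[|k]] /=; rewrite mulr_ge0// invr_ge0; first by rewrite ln0.
      by rewrite ln0.
    by rewrite ln_ge0// ler1n.
  - by move=> k k4; rewrite /= -mulrBr; exact: probability_bad_stage_le.
apply: filterS => w [k1 good].
(* Dividing by 3 fits the loss [3 * e] into [e']; the cap keeps [1 - 3 * e] nonnegative. *)
apply: le_limn_einf => e' e'0; pose e := Num.min (e' / 3) 3^-1.
have e0 : 0 < e by rewrite lt_min; apply/andP; split; lra.
have e1 : e <= 3^-1 by rewrite ge_min lexx orbT.
have e3 : 3 * e <= e' by have : e <= e' / 3 by [rewrite ge_min lexx]; lra.
have [k0 hk0] := num_steps_asymptotic R e e0 e1.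
exists (2 ^ maxn k0 k1)%N => n hn.
have n0 : (0 < n)%N by apply: leq_trans hn; rewrite expn_gt0.
pose k := trunc_log 2 n.
have kn : (2 ^ k <= n < 2 ^ k.+1)%N by exact: trunc_log_bounds.
have := trunc_log_max (isT : (1 < 2)%N) hn; rewrite geq_max -/k => /andP[k0k k1k].
have [k4 hK] := hk0 k k0k.
have rec := num_steps_le_num_records T R d X j0 j1 k n w k4 kn (good k k1k).
have [l1 l2] : k%:R * ln 2 <= ln (n%:R : R) /\ ln (n%:R : R) <= k.+1%:R * ln 2.
  case/andP: kn => kn1 kn2; rewrite !mulr_natl -!lnXn// !ler_ln ?posrE ?exprn_gt0 ?ltr0n//.
  by rewrite -!natrX !ler_nat kn1 ltnW.
have x4 : 4 <= k%:R :> R by rewrite (ler_nat R 4).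
have a2 := ln2_ge R.
have kl : 1 < k%:R * ln 2 :> R by nra.
have ll0 : 0 < ln (k%:R * ln 2 : R) by exact: ln_gt0.
have ll : ln (k%:R * ln 2) <= ln (ln (n%:R : R)) by rewrite ler_ln ?posrE//; lra.
(* The staircase yields the rate with factor 2, and [d * ln (ln n) >= 2 * ln (ln n)] carries it over
   to [d]. *)
have dd : 2 <= d%:R :> R by rewrite (ler_nat R 2).
apply: (@le_trans _ _ (1 - 3 * e)); first by rewrite lerD2l lerN2.
rewrite invf_div mulrA ler_pdivlMr; last lra.
apply: (@le_trans _ _ ((1 - 3 * e) * (k.+1%:R * ln 2))).
  by apply: ler_wpM2l => //; lra.
apply: le_trans hK _; apply: ler_pM => //; first lra.
  by rewrite ler_nat.
by apply: ler_pM => //; lra.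
Qed.
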